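(* Let $\tau$ be the infinite Thue–Morse word and let $\psi$ be the morphism with $\psi(0)=10$, $\psi(1)=11$. Then the infinite word $\psi(\tau)$ is parameterized-cube-free.
   Context: The Thue–Morse word $\tau=0110100110010110\cdots$ is the fixed point starting with $0$ of the morphism $0\mapsto 01$, $1\mapsto 10$. A parameterized square is a word $uv$ with $|u|=|v|\ge 1$ and a bijection $f:\mathrm{Alph}(u)\to\mathrm{Alph}(v)$ ($\mathrm{Alph}$ = set of letters occurring) with $v[t]=f(u[t])$ for all $t$. A parameterized cube is a word $uvw$ with $|u|=|v|=|w|$ such that both $uv$ and $vw$ are parameterized squares. A word is parameterized-cube-free if none of its finite factors is a parameterized cube of length greater than $3$. *)

(* Defs.v *)
From mathcomp Require Import all_boot.
Set Implicit Arguments.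
Unset Strict Implicit.
Unset Printing Implicit Defensive.

(* Finite words are sequences, infinite words are functions on nat.  Binary
   letters are booleans: 0 is false and 1 is true. *)

Definition morph_word (A B : Type) (h : A -> seq B) (u : seq A) : seq B :=
  flatten (map h u).

(* Image of an infinite word under a non-erasing morphism: the image of the
   prefix of length n + 1 has at least n + 1 letters, so the default letter b0
   is never used (see morph_infP). *)
Definition morph_inf (A B : Type) (b0 : B) (h : A -> seq B) (x : nat -> A) :
    nat -> B :=
  fun n => nth b0 (morph_word h (mkseq x n.+1)) n.

Definition factor (A : Type) (s : seq A) (x : nat -> A) : Prop :=
  exists i, s = mkseq (fun k => x (i + k)) (size s).

(* f restricts to a bijection from the letters of u onto the letters of v. *)
Definition alph_bij (A : eqType) (f : A -> A) (u v : seq A) : Prop :=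
  [/\ {in u, forall a, f a \in v},
      {in u &, injective f} &
      {in v, forall b, exists2 a, a \in u & f a = b}].

Definition param_square (A : eqType) (s : seq A) : Prop :=
  exists u v : seq A,
    [/\ s = u ++ v, size u = size v, 0 < size u &
        exists2 f : A -> A, alph_bij f u v & v = map f u].

Definition param_cube (A : eqType) (s : seq A) : Prop :=
  exists u v w : seq A,
    [/\ s = u ++ v ++ w, size u = size v, size v = size w,
        param_square (u ++ v) & param_square (v ++ w)].

Definition param_cube_free (A : eqType) (x : nat -> A) : Prop :=
  forall s : seq A, factor s x -> 3 < size s -> ~ param_cube s.

Definition mu (a : bool) : seq bool :=
  if a then [:: true; false] else [:: false; true].

Definition psi (a : bool) : seq bool :=
  if a then [:: true; true] else [:: true; false].

Definition is_thue_morse (x : nat -> bool) : Prop :=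
  x 0 = false /\ morph_inf false mu x =1 x.

Lemma size_morph_word (A B : Type) (h : A -> seq B) (u : seq A) :
  (forall a, 0 < size (h a)) -> size u <= size (morph_word h u).
Proof.
move=> h_gt0; elim: u => //= a u IHu.
by rewrite /morph_word /= size_cat -add1n leq_add.
Qed.

Lemma morph_infP (A B : Type) (b0 : B) (h : A -> seq B) (x : nat -> A) n :
  (forall a, 0 < size (h a)) ->
  morph_word h (mkseq x n) =
    mkseq (morph_inf b0 h x) (size (morph_word h (mkseq x n))).
Proof.
move=> h_gt0; apply: (@eq_from_nth _ b0) => [|i lt_i]; first by rewrite size_mkseq.
rewrite nth_mkseq // /morph_inf.
have szP m : m <= size (morph_word h (mkseq x m)).
  by rewrite -{1}(size_mkseq x m) size_morph_word.
have pre p q j : p <= q -> j < size (morph_word h (mkseq x p)) ->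
  nth b0 (morph_word h (mkseq x q)) j = nth b0 (morph_word h (mkseq x p)) j.
  move=> le_pq lt_j; rewrite -(subnKC le_pq) /mkseq iotaD map_cat.
  by rewrite /morph_word map_cat flatten_cat nth_cat lt_j.
case: (leqP n i.+1) => [le_n|/ltnW le_n]; first by rewrite (pre _ _ _ le_n).
by apply: pre.
Qed.

Lemma morph_inf_mu (x : nat -> bool) n :
  morph_inf false mu x n = odd n (+) x n./2.
Proof.
have H (y : nat -> bool) m k : k < m.*2 ->
    nth false (morph_word mu (mkseq y m)) k = odd k (+) y k./2.
  elim: m y k => // m IHm y k lt_k.
  rewrite /mkseq /= -[1]addn0 iotaDl -map_comp.
  case: k lt_k => [|[|k]] lt_k; rewrite /morph_word /=; try by case: (y 0).
  have := IHm (y \o S) k lt_k; rewrite /morph_word /mkseq /= negbK => <-.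
  by case: (y 0).
by apply: H; rewrite -addnn addSn ltnS leq_addr.
Qed.

Lemma thue_morse_exists : exists x, is_thue_morse x.
Proof.
pose fix t (k n : nat) {struct k} : bool :=
  if k is k'.+1 then odd n (+) t k' n./2 else false.
have t0 k : t k 0 = false by elim: k.
have tE k m n : n <= k -> n <= m -> t k n = t m n.
  elim: k m n => [|k IHk] [|m] [|n] //; rewrite ?t0 // => le_k le_m.
  rewrite [LHS]/= [RHS]/=; congr (_ (+) _).
  have le_h : uphalf n <= n by rewrite leq_uphalf_double -addnn leq_addr.
  by apply: IHk; apply: leq_trans le_h _.
exists (fun n => t n n); split=> // n; rewrite morph_inf_mu.
rewrite -[RHS](tE n.+1) // [RHS]/=; congr (_ (+) _); apply: tE => //.
by rewrite leq_half_double -addnn leqW // leq_addr.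
Qed.

Lemma thue_morse_unique x y : is_thue_morse x -> is_thue_morse y -> x =1 y.
Proof.
move=> [x0 xP] [y0 yP] n; elim/ltn_ind: n => -[|n] IHn; first by rewrite x0 y0.
rewrite -xP -yP !morph_inf_mu IHn // /= ltnS leq_uphalf_double.
by rewrite -addnn leq_addr.
Qed.

(* Main.v *)
Require Import Defs.
From mathcomp Require Import all_boot.
From mathcomp Require Import zify.

(** The even positions of [psi tau] all carry the letter 1, and its odd
    positions spell out [tau].  Over a binary alphabet a parameterized square
    is a word [u ++ v] in which [v] is [u] or its complement.

    If the period is even, position parity is preserved, so the letters 1 at
    even positions exclude the complement, and a parameterized cube yields an
    ordinary cube in [tau] at half the period.  If the period is odd and at
    least 3, a parity swap matches every odd position of [u ++ v] with an even
    one, so all odd positions carry the same letter, giving three equal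
    consecutive letters in [tau].  Neither occurs in [tau]: a cube of even
    period descends to half the period, and one of odd period at least 3
    would alternate, since [tau (2 a) != tau (2 a + 1)] on both parities, which
    again forces three equal consecutive letters. *)

(** Since [psi a] is 1 followed by [a], an even position, where the implication is vacuous, carries
    1. *)
Lemma morph_inf_psi (x : nat -> bool) n :
  morph_inf false psi x n = odd n ==> x n./2.
Proof.
have nth_psi (y : nat -> bool) m k : k < m.*2 ->
    nth false (morph_word psi (mkseq y m)) k = odd k ==> y k./2.
  elim: m y k => // m IHm y k lt_k.
  rewrite /mkseq /= -[1]addn0 iotaDl -map_comp.
  case: k lt_k => [|[|k]] lt_k; rewrite /morph_word /=; try by case: (y 0).
  have := IHm (y \o S) k lt_k; rewrite /morph_word /mkseq /= negbK => <-.
  by case: (y 0).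
by apply: nth_psi; rewrite -addnn addSn ltnS leq_addr.
Qed.

Lemma morph_inf_psi_double (x : nat -> bool) k : morph_inf false psi x k.*2.
Proof. by rewrite morph_inf_psi odd_double. Qed.

Lemma morph_inf_psi_doubleS (x : nat -> bool) k :
  morph_inf false psi x k.*2.+1 = x k.
Proof. by rewrite morph_inf_psi /= odd_double uphalf_double. Qed.

Section ThueMorse.

Variables (tau : nat -> bool) (htau : is_thue_morse tau).

Lemma thue_morse_double k : tau k.*2 = tau k.
Proof. by rewrite -htau.2 morph_inf_mu odd_double doubleK. Qed.

Lemma thue_morse_doubleS k : tau k.*2.+1 = ~~ tau k.
Proof. by rewrite -htau.2 morph_inf_mu /= odd_double uphalf_double. Qed.

(** One of the two adjacent pairs starts at an even position, so it is the image under [mu] of one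
    letter. *)
Lemma thue_morse_no_triple j : tau j = tau j.+1 -> tau j.+1 = tau j.+2 -> False.
Proof.
have pair_neq k : tau k.*2 = tau k.*2.+1 -> False.
  by rewrite thue_morse_double thue_morse_doubleS; case: (tau k).
rewrite -(odd_double_half j); case: (odd j) => /= eq1 eq2.
- by apply: (pair_neq j./2.+1); rewrite doubleS.
- exact: (pair_neq j./2).
Qed.

Lemma thue_morse_cube_free j m :
  0 < m -> (forall k, k < m.*2 -> tau (j + k + m) = tau (j + k)) -> False.
Proof.
elim/ltn_ind: m j => m IHm j m_gt0 per.
have perq q : j <= q < j + m.*2 -> tau (q + m) = tau q.
  by move=> q_in; have := per (q - j); rewrite subnKC; [apply|]; lia.
have [odd_m|even_m] := boolP (odd m); last first.
  have m_eq : m = m./2.*2 by lia.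
  (* Rounding up keeps the doubled indices in range: they lie between [j] and [j + m.*2 - 1]. *)
  apply: (IHm m./2 _ (uphalf j)); [lia | lia |] => k lt_k.
  rewrite -(thue_morse_double (_ + m./2)) -(thue_morse_double (_ + k)) doubleD -m_eq; apply: perq; lia.
case: (posnP m./2) => [m1|m_ge3].
  have {m1 odd_m} m1 : m = 1 by lia.
  subst m; apply: (@thue_morse_no_triple j).
  - by rewrite -[j.+1]addn1 perq //; lia.
  - by rewrite -[j.+2]addn1 perq //; lia.
(* The odd period [m] moves a pair starting at an odd position onto one starting at an even
   position. *)
have alt q : j <= q -> q.+1 < j + m.*2 -> tau q.+1 = ~~ tau q.
  move=> le_q lt_q; have [odd_q|even_q] := boolP (odd q).
    rewrite -(perq q) -?(perq q.+1); [|lia|lia].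
    have -> : q.+1 + m = (q + m)./2.*2.+1 by lia.
    have -> : q + m = (q + m)./2.*2 by lia.
    by rewrite doubleK thue_morse_doubleS thue_morse_double.
  have -> : q = q./2.*2 by lia.
  by rewrite thue_morse_doubleS thue_morse_double.
have alt2 a : j <= a.*2 -> a.*2.+2 < j + m.*2 -> tau a = tau a.+1.
  move=> le_a lt_a; rewrite -(thue_morse_double a) -(thue_morse_double a.+1).
  by rewrite doubleS !alt ?negbK //; lia.
by apply: (@thue_morse_no_triple (uphalf j)); apply: alt2; lia.
Qed.

End ThueMorse.

(** A single letter in [u] fixes [c]; if both letters occur, injectivity makes their images
    differ. *)
Lemma inj_on_bool (f : bool -> bool) (u : seq bool) :
  {in u &, injective f} -> exists c, {in u, forall a, f a = c (+) a}.
Proof.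
move=> inj_f; case ut: (true \in u); last first.
  by exists (f false) => -[]; rewrite ?ut ?addbF.
case uf: (false \in u); last first.
  by exists (~~ f true) => -[]; rewrite ?uf ?addbT ?negbK.
exists (f false) => -[] _; rewrite ?addbF // addbT.
have : f true <> f false by move/(inj_f _ _ ut uf).
by case: (f true); case: (f false).
Qed.

Lemma param_square_xor (u v : seq bool) :
  size u = size v -> param_square (u ++ v) ->
  exists c, forall k, k < size u -> nth false v k = c (+) nth false u k.
Proof.
move=> szuv [u' [v' [eq_s sz' _ [f [_ inj_f _] v'E]]]].
(* Equal lengths force the halves from the definition to be [u] and [v]. *)
have szu : size u' = size u.
  by have := congr1 size eq_s; rewrite !size_cat -szuv -sz' !addnn => /double_inj.
have /andP[/eqP eq_u /eqP eq_v] : (u' == u) && (v' == v).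
  by rewrite -eqseq_cat // eq_s.
subst u' v'; have [c fc] := @inj_on_bool f u inj_f; exists c => k lt_k.
by rewrite -eq_v (nth_map false) // fc // mem_nth.
Qed.

Section PsiThueMorse.

Variables (tau : nat -> bool) (htau : is_thue_morse tau).

Let p := morph_inf false psi tau.

Lemma psi_thue_morse_no_odd_square i n c :
  odd n -> 1 < n -> (forall k, k < n -> p (i + n + k) = c (+) p (i + k)) -> False.
Proof.
move=> odd_n n_gt1 sq.
have sqq q : i <= q < i + n -> p (q + n) = c (+) p q.
  move=> q_in; have := sq (q - i).
  have -> : i + n + (q - i) = q + n by lia.
  by rewrite subnKC; [apply|]; lia.
(* A shift by [n], forward from the first half or back from the second, reaches an even position,
   which carries 1. *)
have constp a : i <= a.*2.+1 < i + n.*2 -> tau a = ~~ c.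
  move=> a_in; rewrite -(morph_inf_psi_doubleS tau) -/p.
  have [lt_a|le_a] := ltnP a.*2.+1 (i + n).
    have := sqq a.*2.+1; have -> : a.*2.+1 + n = (a.*2.+1 + n)./2.*2 by lia.
    rewrite {1}/p morph_inf_psi_double => /(_ ltac:(lia)).
    by case: c {sq sqq}; case: (p _).
  have := sqq (a.*2.+1 - n); rewrite subnK; last by lia.
  have -> : a.*2.+1 - n = (a.*2.+1 - n)./2.*2 by lia.
  by rewrite [X in _ (+) X]/p morph_inf_psi_double addbT; apply; lia.
by apply: (@thue_morse_no_triple tau htau i./2); rewrite !constp; lia.
Qed.

Lemma psi_thue_morse_no_even_cube i n c d :
  ~~ odd n -> 0 < n ->
  (forall k, k < n -> p (i + n + k) = c (+) p (i + k)) ->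
  (forall k, k < n -> p (i + n.*2 + k) = d (+) p (i + n + k)) -> False.
Proof.
move=> even_n n_gt0 sq1 sq2.
have p_even q : ~~ odd q -> p q by move=> ev; rewrite /p morph_inf_psi (negbTE ev).
(* Position [i + odd i] is even, and so are its shifts by [n]; all carry 1. *)
have c0 : c = false.
  have := sq1 (odd i) ltac:(lia); rewrite !p_even; [by case: c {sq1}|lia|lia].
have d0 : d = false.
  have := sq2 (odd i) ltac:(lia); rewrite !p_even; [by case: d {sq2}|lia|lia].
subst c d; apply: (@thue_morse_cube_free tau htau i./2 n./2); first lia.
move=> k lt_k.
rewrite -[LHS](morph_inf_psi_doubleS tau) -[RHS](morph_inf_psi_doubleS tau) -/p.
set q := (i./2 + k).*2.+1; have -> : (i./2 + k + n./2).*2.+1 = q + n by lia.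
have [lt_q|le_q] := ltnP q (i + n).
  have := sq1 (q - i) ltac:(lia); rewrite addFb.
  by have [-> ->] : i + n + (q - i) = q + n /\ i + (q - i) = q by lia.
have := sq2 (q - i - n) ltac:(lia); rewrite addFb.
by have [-> ->] : i + n.*2 + (q - i - n) = q + n /\ i + n + (q - i - n) = q by lia.
Qed.

End PsiThueMorse.

Theorem theorem35 (tau : nat -> bool) (htau : is_thue_morse tau) :
  param_cube_free (morph_inf false psi tau).
Proof.
move=> s [i s_fac] sz_s [u [v [w [s_eq szuv szvw sq1 sq2]]]].
have sz_s3 : size s = size u + (size u + size u).
  by rewrite s_eq !size_cat -szvw -szuv.
have nth_s k : k < size s -> nth false s k = morph_inf false psi tau (i + k).
  by move=> lt_k; rewrite s_fac nth_mkseq.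
have nth_u k : k < size u -> nth false u k = morph_inf false psi tau (i + k).
  by move=> lt_k; rewrite -nth_s; [rewrite s_eq nth_cat lt_k | lia].
have nth_v k : k < size u ->
    nth false v k = morph_inf false psi tau (i + size u + k).
  move=> lt_k; rewrite -addnA -nth_s; last lia.
  by rewrite s_eq nth_cat ltnNge leq_addr /= addKn nth_cat -szuv lt_k.
have nth_w k : k < size u ->
    nth false w k = morph_inf false psi tau (i + (size u).*2 + k).
  move=> lt_k; rewrite -addnA -nth_s; last lia.
  rewrite -addnn -addnA s_eq nth_cat ltnNge leq_addr /= addKn.
  by rewrite nth_cat -szuv ltnNge leq_addr /= addKn.
have [c cP] := param_square_xor _ _ szuv sq1.
have [d dP] := param_square_xor _ _ szvw sq2.
have shift1 k : k < size u -> morph_inf false psi tau (i + size u + k) =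
    c (+) morph_inf false psi tau (i + k).
  by move=> lt_k; rewrite -nth_v // -nth_u // cP.
have [odd_u|even_u] := boolP (odd (size u)).
  (* As [size s] is three times [size u] and exceeds 3, [size u] is at least 2. *)
  by apply: (@psi_thue_morse_no_odd_square tau htau i (size u) c)=> //; lia.
apply: (@psi_thue_morse_no_even_cube tau htau i (size u) c d) => //; first lia.
by move=> k lt_k; rewrite -nth_w // -nth_v // dP // -szuv.
Qed.
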